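(* Let $n\ge 2$, $m\ge 2$, and let $H(n,m)$ be a Heisenberg $n$-Lie algebra of dimension $mn+1$ over a field. Then $$\mathcal{M}^{(2)}(H(n,m))\cong A\left(l_{mn}^n(3)\right).$$
   Context: An $n$-Lie algebra is a vector space $L$ over a field with a multilinear skew-symmetric operation $[x_1,\ldots,x_n]$ satisfying $[[x_1,\ldots,x_n],y_2,\ldots,y_n]=\sum_{i=1}^n[x_1,\ldots,[x_i,y_2,\ldots,y_n],\ldots,x_n]$. For subalgebras $L_1,\dots,L_n$ of $L$, $[L_1,\dots,L_n]$ is the subalgebra generated by all $[x_1,\dots,x_n]$ with $x_i\in L_i$. The lower central series is $L^1=L$, $L^{i+1}=[L^i,L,\dots,L]$, and the center is $Z(L)=\{z\in L: [z,L,\dots,L]=0\}$. $L$ is abelian if $L^2=0$; $A(k)$ denotes the abelian $n$-Lie algebra of dimension $k$. An $n$-Lie algebra $L$ is Heisenberg if $L^2=Z(L)$ and $\dim L^2=1$. 2-nilpotent multiplier: let $0\to R\to F\to L\to 0$ be exact with $F$ a free $n$-Lie algebra. Then $\mathcal{M}^{(2)}(L)=\dfrac{R\cap F^{3}}{\gamma_{3}(R,F,\ldots,F)}$, where $\gamma_3(R,F,\dots,F)=[[R,F,\dots,F],F,\dots,F]$. $l_d^n(w)$ is the number of basic commutators of weight $w$ on $d$ letters in the free $n$-Lie algebra $F$ on $d$ generators; the basic commutators of weight $w$ give a basis of $F^w/F^{w+1}$, so $l_d^n(w)=\dim F^w/F^{w+1}$. *)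

(* Defs.v *)
From HB Require Import structures.
From mathcomp Require Import all_boot all_order perm all_algebra.
From mathcomp Require Import boolp classical_sets.

Set Implicit Arguments.
Unset Strict Implicit.
Unset Printing Implicit Defensive.

Import GRing.Theory.
Local Open Scope ring_scope.
Local Open Scope quotient_scope.

(* The n-tuple (a, y_1, ..., y_(n-1)): the entry of y in position 0 is
   discarded. *)
Definition hcons (T : Type) (n : nat) (a : T) (y : 'I_n -> T) : 'I_n -> T :=
  fun j => if j == 0 :> nat then a else y j.

(* Skew-symmetry is taken in its alternating form: it implies the change of
   sign under transpositions, and is equivalent to it outside characteristic
   two. In [brk_fundamental], the i-th summand has [x_i, y_1, ..., y_(n-1)] as
   its i-th entry and the other x_j unchanged. *)
HB.mixin Record isNLie (K : fieldType) (n : nat) L of GRing.Lmodule K L := {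
  brk : ('I_n -> L) -> L;
  brk_linear : forall (i : 'I_n) (x : 'I_n -> L),
    linear (fun v => brk [eta x with i |-> v]);
  brk_alternating : forall (x : 'I_n -> L) (i j : 'I_n),
    i != j -> x i = x j -> brk x = 0;
  brk_fundamental : forall x y : 'I_n -> L,
    brk (hcons (brk x) y) =
    \sum_(i < n) brk [eta x with i |-> brk (hcons (x i) y)]
}.

#[short(type="nLieType")]
HB.structure Definition NLie (K : fieldType) (n : nat) :=
  {L of isNLie K n L & GRing.Lmodule K L}.

Definition nlie_morphism (K : fieldType) (n : nat) (L M : nLieType K n)
    (f : {linear L -> M}) : Prop :=
  forall x : 'I_n -> L, f (brk x) = brk (f \o x).

Definition nlie_isomorphic (K : fieldType) (n : nat) (L M : nLieType K n) :
    Prop :=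
  exists2 f : {linear L -> M}, nlie_morphism f & bijective f.

Definition has_dim (K : fieldType) (V : lmodType K) (d : nat) : Prop :=
  inhabited (Vector.axiom d V).

Section BracketTheory.
Variables (K : fieldType) (n : nat) (L : nLieType K n).
Implicit Types (x y : 'I_n -> L) (i j : 'I_n).

Lemma brk_eq x y : x =1 y -> brk x = brk y.
Proof. by move=> /funext ->. Qed.

Lemma brk_updD x i u v : brk [eta x with i |-> u + v] =
  brk [eta x with i |-> u] + brk [eta x with i |-> v].
Proof. by have := brk_linear i x 1 u v; rewrite !scale1r. Qed.

Lemma brk_updB x i u v : brk [eta x with i |-> u - v] =
  brk [eta x with i |-> u] - brk [eta x with i |-> v].
Proof.
have := brk_linear i x (-1) v u.
by rewrite !scaleN1r (addrC (- v)) (addrC (- brk _)).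
Qed.

Lemma brk_swap x i j : i != j -> brk (x \o tperm i j) = - brk x.
Proof.
move=> ij; have ji : j != i by rewrite eq_sym.
pose z a b := brk [eta [eta x with i |-> a] with j |-> b].
have zz a : z a a = 0.
  by apply: (brk_alternating _ i j) => //=; rewrite !eqxx (negPf ij).
have zDr a b c : z a (b + c) = z a b + z a c by exact: brk_updD.
have zC a b : z a b = brk [eta [eta x with j |-> b] with i |-> a].
  apply: brk_eq => k /=; case: eqVneq => // ->; by rewrite (negPf ji).
have zDl a b c : z (a + b) c = z a c + z b c by rewrite !zC brk_updD.
have := zz (x i + x j); rewrite zDr !zDl !zz add0r addr0 => /eqP.
rewrite addrC addr_eq0 => /eqP zE.
have -> : brk x = z (x i) (x j).
  by apply: brk_eq => k /=; do 2 case: eqVneq => [->|?] //.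
rewrite -[LHS]opprK; congr (- _); rewrite zE; congr (- _).
apply: brk_eq => k /=.
by case: tpermP => [->|->|/eqP/negPf-> /eqP/negPf->]; rewrite ?eqxx ?(negPf ij).
Qed.

End BracketTheory.

Section Subalgebras.
Variables (K : fieldType) (n : nat) (L : nLieType K n).

Record nsubalg := NSubalg {
  nsubalg_pred :> {pred L};
  nsubalg_submod : submod_closed nsubalg_pred;
  nsubalg_brk : forall x : 'I_n -> L,
    (forall i, x i \in nsubalg_pred) -> brk x \in nsubalg_pred
}.

Record nideal := NIdeal {
  nideal_alg :> nsubalg;
  nideal_brk : forall (x : 'I_n -> L) (i : 'I_n),
    x i \in nideal_alg -> brk x \in nideal_alg
}.

HB.instance Definition _ (A : nsubalg) :=
  GRing.isSubmodClosed.Build K L (nsubalg_pred A) (nsubalg_submod A).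


Definition full_subalg : nsubalg :=
  @NSubalg predT (conj isT (fun _ _ _ _ _ => isT)) (fun _ _ => isT).

Definition full_ideal : nideal := @NIdeal full_subalg (fun _ _ _ => isT).

Section Meet.
Variables A B : nsubalg.

Fact meet_submod : submod_closed [predI A & B].
Proof.
split=> [|a u v /andP[uA uB] /andP[vA vB]]; rewrite inE ?rpred0//.
by rewrite !rpredD ?rpredZ.
Qed.

Fact meet_brk (x : 'I_n -> L) :
  (forall i, x i \in [predI A & B]) -> brk x \in [predI A & B].
Proof.
move=> xAB; rewrite inE; apply/andP.
by split; apply: nsubalg_brk => i; have /andP[] := xAB i.
Qed.

Definition meet_subalg : nsubalg := NSubalg meet_submod meet_brk.
End Meet.

Section Generated.
Variable G : set L.

Definition gen_pred : {pred L} :=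
  fun v => `[< forall A : nsubalg, (forall g, G g -> g \in A) -> v \in A >].

Lemma gen_predP v :
  reflect (forall A : nsubalg, (forall g, G g -> g \in A) -> v \in A)
          (v \in gen_pred).
Proof. exact: asboolP. Qed.

Fact gen_submod : submod_closed gen_pred.
Proof.
split=> [|a u v /gen_predP uG /gen_predP vG]; apply/gen_predP => A GA.
  exact: rpred0.
by rewrite rpredD ?rpredZ ?uG ?vG.
Qed.

Fact gen_brk (x : 'I_n -> L) :
  (forall i, x i \in gen_pred) -> brk x \in gen_pred.
Proof.
move=> xG; apply/gen_predP => A GA; apply: nsubalg_brk => i.
by have /gen_predP := xG i; exact.
Qed.

Definition gen_subalg : nsubalg := NSubalg gen_submod gen_brk.

Lemma gen_sub g : G g -> g \in gen_subalg.
Proof. by move=> Gg; apply/gen_predP => A; exact. Qed.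

Lemma gen_min (A : nsubalg) :
  (forall g, G g -> g \in A) -> {subset gen_subalg <= A}.
Proof. by move=> GA v /gen_predP; exact. Qed.

End Generated.

(* [S_1, ..., S_n] *)
Definition nprod (S : 'I_n -> nsubalg) : nsubalg :=
  gen_subalg [set brk x | x in [set x | forall i, x i \in S i]].

Section IdealProduct.
Variable I : nideal.

Definition lprod_subalg : nsubalg :=
  nprod (hcons (nideal_alg I) (fun=> nideal_alg full_ideal)).

Lemma lprod_gen (x : 'I_n -> L) (o : 'I_n) :
  o = 0 :> nat -> x o \in I -> brk x \in lprod_subalg.
Proof.
move=> o0 xoI; apply: gen_sub; exists x => // i; rewrite /hcons.
by case: eqP => // i0; rewrite (_ : i = o) //; apply: val_inj; rewrite /= o0.
Qed.

Lemma lprod_sub (o : 'I_n) : o = 0 :> nat -> {subset lprod_subalg <= I}.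
Proof.
move=> o0; apply: gen_min => _ [x xI <-]; apply: (@nideal_brk I x o).
by have := xI o; rewrite /hcons o0.
Qed.

Fact lprod_brk (x : 'I_n -> L) (i : 'I_n) :
  x i \in lprod_subalg -> brk x \in lprod_subalg.
Proof.
pose o := Ordinal (leq_ltn_trans (leq0n i) (ltn_ord i)).
have o0 : o = 0 :> nat by [].
move=> xiP; have xiI := lprod_sub o0 xiP.
case: (eqVneq i o) => [io|io]; first by apply: (lprod_gen o0); rewrite -io.
rewrite -[brk x]opprK -(brk_swap x io) rpredN.
by apply: (lprod_gen o0) => /=; rewrite tpermR.
Qed.

(* [I, L, ..., L] *)
Definition lprod : nideal := @NIdeal lprod_subalg lprod_brk.

End IdealProduct.

Lemma lprod_subset (I : nideal) : (0 < n)%N -> {subset lprod I <= I}.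
Proof. by move=> n_gt0; exact: (@lprod_sub I (Ordinal n_gt0)). Qed.

Lemma lprodS (I J : nideal) :
  {subset I <= J} -> {subset lprod I <= lprod J}.
Proof.
move=> IJ; apply: gen_min => _ [x xI <-]; apply: gen_sub; exists x => // i.
by have := xI i; rewrite /hcons; case: ifP => // _; exact: IJ.
Qed.

(* L^i, for i >= 1 *)
Definition lcs (i : nat) : nideal := iter i.-1 lprod full_ideal.

Definition center : {pred L} :=
  fun z => `[< forall y : 'I_n -> L, brk (hcons z y) = 0 >].

End Subalgebras.

Arguments full_ideal {K n} L.
Arguments lcs {K n} L i.
Arguments center {K n} L.

Section SubNLie.
Variables (K : fieldType) (n : nat) (L : nLieType K n) (A : nsubalg L).

Record sub_nlie := SubNLie { sub_val : L; _ : sub_val \in A }.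

HB.instance Definition _ := [isSub for sub_val].
HB.instance Definition _ := [Choice of sub_nlie by <:].
HB.instance Definition _ := [SubChoice_isSubLmodule of sub_nlie by <:].

Fact sub_brk_proof (x : 'I_n -> sub_nlie) : brk (sub_val \o x) \in A.
Proof. by apply: nsubalg_brk => i; exact: valP (x i). Qed.

Definition sub_brk (x : 'I_n -> sub_nlie) : sub_nlie :=
  SubNLie (sub_brk_proof x).

Lemma sub_val_upd (x : 'I_n -> sub_nlie) i v :
  sub_val \o [eta x with i |-> v] =
  [eta (sub_val \o x) with i |-> sub_val v].
Proof. by apply/funext => j /=; case: ifP. Qed.

Lemma sub_val_hcons v (x : 'I_n -> sub_nlie) :
  sub_val \o hcons v x = hcons (sub_val v) (sub_val \o x).
Proof. by apply/funext => j; rewrite /hcons /=; case: ifP. Qed.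

Fact sub_brk_linear i (x : 'I_n -> sub_nlie) :
  linear (fun v => sub_brk [eta x with i |-> v]).
Proof.
move=> a u v; apply: val_inj; rewrite linearP /= !sub_val_upd.
exact: brk_linear.
Qed.

Fact sub_brk_alternating (x : 'I_n -> sub_nlie) i j :
  i != j -> x i = x j -> sub_brk x = 0.
Proof.
move=> ij xij; apply: val_inj; rewrite raddf0 /=.
by apply: (brk_alternating _ _ _ ij) => /=; rewrite xij.
Qed.

Fact sub_brk_fundamental (x y : 'I_n -> sub_nlie) :
  sub_brk (hcons (sub_brk x) y) =
  \sum_(i < n) sub_brk [eta x with i |-> sub_brk (hcons (x i) y)].
Proof.
apply: val_inj; rewrite raddf_sum /= sub_val_hcons /= brk_fundamental.
by apply: eq_bigr => i _ /=; rewrite sub_val_upd /= sub_val_hcons.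
Qed.

HB.instance Definition _ := isNLie.Build K n sub_nlie
  sub_brk_linear sub_brk_alternating sub_brk_fundamental.

End SubNLie.

Section QuotNLie.
Variables (K : fieldType) (n : nat) (L : nLieType K n) (I : nideal L).

Definition quot_nlie : Type := Quotient.quot (nsubalg_pred I).

HB.instance Definition _ := GRing.Zmodule.on quot_nlie.
HB.instance Definition _ := Quotient.on quot_nlie.

Definition quot_pi (v : L) : quot_nlie := \pi v.
Definition quot_repr (v : quot_nlie) : L := repr v.

Lemma quot_reprK : cancel quot_repr quot_pi.
Proof. exact: reprK. Qed.

Lemma quot_piP u v : reflect (quot_pi u = quot_pi v) (u - v \in I).
Proof. by rewrite Quotient.idealrBE; exact: eqP. Qed.

Lemma quot_piD u v : quot_pi (u + v) = quot_pi u + quot_pi v.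
Proof. exact: Quotient.pi_add. Qed.

Definition quot_scale (a : K) (v : quot_nlie) : quot_nlie :=
  quot_pi (a *: quot_repr v).

Lemma quot_piZ a v : quot_pi (a *: v) = quot_scale a (quot_pi v).
Proof.
apply/quot_piP; rewrite -scalerBr rpredZ //.
by apply/quot_piP; rewrite quot_reprK.
Qed.

Fact quot_scalerA a b v : quot_scale a (quot_scale b v) = quot_scale (a * b) v.
Proof. by rewrite -[v]quot_reprK -!quot_piZ scalerA. Qed.
Fact quot_scale1r : left_id 1 quot_scale.
Proof. by move=> v; rewrite -[v]quot_reprK -!quot_piZ scale1r. Qed.
Fact quot_scalerDr : right_distributive quot_scale +%R.
Proof.
move=> a u v; rewrite -[u]quot_reprK -[v]quot_reprK.
by rewrite -quot_piD -!quot_piZ -quot_piD scalerDr.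
Qed.
Fact quot_scalerDl v : {morph quot_scale^~ v : a b / a + b}.
Proof.
by move=> a b; rewrite -[v]quot_reprK -!quot_piZ -quot_piD scalerDl.
Qed.

HB.instance Definition _ := GRing.Zmodule_isLmodule.Build K quot_nlie
  quot_scalerA quot_scale1r quot_scalerDr quot_scalerDl.

Fact quot_pi_linear : linear quot_pi.
Proof. by move=> a u v; rewrite quot_piD quot_piZ. Qed.

HB.instance Definition _ :=
  GRing.isLinear.Build K L quot_nlie *:%R quot_pi quot_pi_linear.

Definition quot_brk (x : 'I_n -> quot_nlie) : quot_nlie :=
  quot_pi (brk (quot_repr \o x)).

Lemma quot_pi_brk (x : 'I_n -> L) : quot_pi (brk x) = quot_brk (quot_pi \o x).
Proof.
rewrite /quot_brk; set x' := quot_repr \o _.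
have xx' i : x i - x' i \in I by apply/quot_piP; rewrite quot_reprK.
pose z k : 'I_n -> L := fun i => if (i < k)%N then x' i else x i.
have zS k : (k <= n)%N -> quot_pi (brk x) = quot_pi (brk (z k)).
  elim: k => [|k IHk] kn; first by congr quot_pi; apply: brk_eq => i.
  rewrite IHk ?(ltnW kn) //; apply/quot_piP; pose o := Ordinal kn.
  have -> : brk (z k) = brk [eta z k with o |-> x o].
    apply: brk_eq => i /=; case: eqVneq => [->|//].
    by rewrite /z ltnn.
  have -> : brk (z k.+1) = brk [eta z k with o |-> x' o].
    apply: brk_eq => i /=; case: eqVneq => [->|io].
      by rewrite /z ltnSn.
    by rewrite /z ltnS leq_eqVlt -[_ == k :> nat]/(i == o) (negPf io).
  by rewrite -brk_updB; apply: (@nideal_brk _ _ _ I _ o); rewrite /= eqxx.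
by rewrite (zS n) //; congr quot_pi; apply: brk_eq => i; rewrite /z ltn_ord.
Qed.

Lemma quot_pi_upd (x : 'I_n -> L) i v :
  quot_pi \o [eta x with i |-> v] = [eta (quot_pi \o x) with i |-> quot_pi v].
Proof. by apply/funext => j /=; case: ifP. Qed.

Lemma quot_pi_hcons v (x : 'I_n -> L) :
  hcons (quot_pi v) (quot_pi \o x) = quot_pi \o hcons v x.
Proof. by apply/funext => j; rewrite /hcons /=; case: ifP. Qed.

Lemma quot_liftE (x : 'I_n -> quot_nlie) : x = quot_pi \o (quot_repr \o x).
Proof. by apply/funext => i /=; rewrite quot_reprK. Qed.

Fact quot_brk_linear i (x : 'I_n -> quot_nlie) :
  linear (fun v => quot_brk [eta x with i |-> v]).
Proof.
move=> a u v; rewrite (quot_liftE x) -[u]quot_reprK -[v]quot_reprK -linearP /=.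
by rewrite -!quot_pi_upd -!quot_pi_brk brk_linear linearP.
Qed.

Fact quot_brk_alternating (x : 'I_n -> quot_nlie) i j :
  i != j -> x i = x j -> quot_brk x = 0.
Proof.
move=> ij xij; rewrite /quot_brk (brk_alternating _ _ _ ij) ?linear0 //=.
by rewrite xij.
Qed.

Fact quot_brk_fundamental (x y : 'I_n -> quot_nlie) :
  quot_brk (hcons (quot_brk x) y) =
  \sum_(i < n) quot_brk [eta x with i |-> quot_brk (hcons (x i) y)].
Proof.
rewrite (quot_liftE x) (quot_liftE y) -quot_pi_brk quot_pi_hcons -quot_pi_brk.
rewrite brk_fundamental raddf_sum; apply: eq_bigr => i _ /=.
by rewrite quot_pi_brk quot_pi_upd quot_pi_brk -quot_pi_hcons.
Qed.

HB.instance Definition _ := isNLie.Build K n quot_nlie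
  quot_brk_linear quot_brk_alternating quot_brk_fundamental.

End QuotNLie.

Section Subquotient.
Variables (K : fieldType) (n : nat) (L : nLieType K n).
Variables (A : nsubalg L) (I : nideal L).

Definition trace_pred : {pred sub_nlie A} := fun v => sub_val v \in I.

Fact trace_submod : submod_closed trace_pred.
Proof.
split=> [|a u v uI vI]; first exact: rpred0.
by rewrite -[_ \in _]/(val (a *: u + v) \in I) linearP rpredD ?rpredZ.
Qed.

Fact trace_brk (x : 'I_n -> sub_nlie A) :
  (forall i, x i \in trace_pred) -> brk x \in trace_pred.
Proof. by move=> xI; rewrite unfold_in /=; apply: nsubalg_brk. Qed.

Fact trace_absorb (x : 'I_n -> sub_nlie A) (i : 'I_n) :
  x i \in NSubalg trace_submod trace_brk ->
  brk x \in NSubalg trace_submod trace_brk.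
Proof.
by move=> xI; rewrite unfold_in /=; apply: (@nideal_brk _ _ _ I _ i).
Qed.

Definition trace_ideal : nideal (sub_nlie A) := NIdeal trace_absorb.

(* A / (A \cap I), that is A / I when I is contained in A *)
Definition subquot : nLieType K n := quot_nlie trace_ideal.

End Subquotient.

Section FreeNLie.
Variables (K : fieldType) (n : nat).

Definition is_free (X : Type) (F : nLieType K n) (iota : X -> F) : Prop :=
  forall (L : nLieType K n) (f : X -> L),
    (exists2 phi : {linear F -> L},
       nlie_morphism phi & forall x, phi (iota x) = f x) /\
    (forall phi psi : {linear F -> L}, nlie_morphism phi -> nlie_morphism psi ->
       (forall x, phi (iota x) = psi (iota x)) -> phi =1 psi).

Variable X : Type.

Inductive nterm :=
  | NVar of X
  | NZero
  | NAdd of nterm & nterm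
  | NScale of K & nterm
  | NBrk of ('I_n -> nterm).

Fixpoint neval (L : nLieType K n) (f : X -> L) (t : nterm) : L :=
  match t with
  | NVar x => f x
  | NZero => 0
  | NAdd s t => neval f s + neval f t
  | NScale a t => a *: neval f t
  | NBrk ts => brk (fun i => neval f (ts i))
  end.

(* Terms are identified when they agree under every valuation in every n-Lie
   algebra over K. *)
Definition nterm_equiv (s t : {classic nterm}) : bool :=
  `[< forall (L : nLieType K n) (f : X -> L), neval f s = neval f t >].

Fact nterm_equivP s t : reflect
  (forall (L : nLieType K n) (f : X -> L), neval f s = neval f t)
  (nterm_equiv s t).
Proof. exact: asboolP. Qed.

Fact nterm_equiv_class : equiv_class_of nterm_equiv.
Proof.
split=> [s|s t|t s u].
- exact/nterm_equivP.
- by apply/nterm_equivP/nterm_equivP => st L f; rewrite st.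
- move=> /nterm_equivP st /nterm_equivP tu; apply/nterm_equivP => L f.
  by rewrite st.
Qed.

Canonical nterm_equiv_equiv := EquivRelPack nterm_equiv_class.
Canonical nterm_equiv_encModRel := defaultEncModRel nterm_equiv.

Definition free_nlie : Type := {eq_quot nterm_equiv}.

HB.instance Definition _ := Choice.on free_nlie.

Definition fpi (t : nterm) : free_nlie := \pi_{eq_quot nterm_equiv} t.
Definition frepr (u : free_nlie) : nterm := repr (u : {eq_quot nterm_equiv}).

Definition fvar (x : X) : free_nlie := fpi (NVar x).
Definition fzero : free_nlie := fpi NZero.
Definition fadd (u v : free_nlie) := fpi (NAdd (frepr u) (frepr v)).
Definition fscale (a : K) (u : free_nlie) := fpi (NScale a (frepr u)).
Definition fopp (u : free_nlie) := fscale (-1) u.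
Definition fbrk (x : 'I_n -> free_nlie) := fpi (NBrk (frepr \o x)).

Definition feval (L : nLieType K n) (f : X -> L) (u : free_nlie) : L :=
  neval f (frepr u).

Section Eval.
Variables (L : nLieType K n) (f : X -> L).

Lemma feval_pi t : feval f (fpi t) = neval f t.
Proof.
suff /nterm_equivP : nterm_equiv (frepr (fpi t)) t by exact.
by have /eqP := reprK (fpi t : {eq_quot nterm_equiv}); rewrite eqmodE.
Qed.

Lemma feval_var x : feval f (fvar x) = f x.
Proof. exact: feval_pi. Qed.
Lemma feval0 : feval f fzero = 0.
Proof. exact: feval_pi. Qed.
Lemma fevalD u v : feval f (fadd u v) = feval f u + feval f v.
Proof. exact: feval_pi. Qed.
Lemma fevalZ a u : feval f (fscale a u) = a *: feval f u.
Proof. exact: feval_pi. Qed.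
Lemma fevalN u : feval f (fopp u) = - feval f u.
Proof. by rewrite fevalZ scaleN1r. Qed.
Lemma feval_brk x : feval f (fbrk x) = brk (feval f \o x).
Proof. exact: feval_pi. Qed.

End Eval.

Lemma feval_inj u v :
  (forall (L : nLieType K n) (f : X -> L), feval f u = feval f v) -> u = v.
Proof.
move=> uv; rewrite -[u]reprK -[v]reprK; apply/eqP; rewrite eqmodE.
exact/nterm_equivP.
Qed.

Let fE := (feval0, fevalD, fevalN, fevalZ, feval_brk).

Fact faddA : associative fadd.
Proof. by move=> u v w; apply: feval_inj => L f; rewrite !fE addrA. Qed.
Fact faddC : commutative fadd.
Proof. by move=> u v; apply: feval_inj => L f; rewrite !fE addrC. Qed.
Fact fadd0 : left_id fzero fadd.
Proof. by move=> u; apply: feval_inj => L f; rewrite !fE add0r. Qed.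
Fact faddN : left_inverse fzero fopp fadd.
Proof.
by move=> u; apply: feval_inj => L f; rewrite fevalD fevalN feval0 addNr.
Qed.

HB.instance Definition _ :=
  GRing.isZmodule.Build free_nlie faddA faddC fadd0 faddN.

Fact fscalerA a b v : fscale a (fscale b v) = fscale (a * b) v.
Proof. by apply: feval_inj => L f; rewrite !fE scalerA. Qed.
Fact fscale1r : left_id 1 fscale.
Proof. by move=> u; apply: feval_inj => L f; rewrite !fE scale1r. Qed.
Fact fscalerDr : right_distributive fscale +%R.
Proof. by move=> a u v; apply: feval_inj => L f; rewrite !fE scalerDr. Qed.
Fact fscalerDl v : {morph fscale^~ v : a b / a + b}.
Proof. by move=> a b; apply: feval_inj => L f; rewrite !fE scalerDl. Qed.

HB.instance Definition _ := GRing.Zmodule_isLmodule.Build K free_nlie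
  fscalerA fscale1r fscalerDr fscalerDl.

Fact feval_linear (L : nLieType K n) (f : X -> L) : linear (feval f).
Proof. by move=> a u v; rewrite fevalD fevalZ. Qed.

HB.instance Definition _ (L : nLieType K n) (f : X -> L) :=
  GRing.isLinear.Build K free_nlie L *:%R (feval f) (feval_linear f).

Lemma feval_upd (L : nLieType K n) (f : X -> L) (x : 'I_n -> free_nlie) i v :
  feval f \o [eta x with i |-> v] = [eta (feval f \o x) with i |-> feval f v].
Proof. by apply/funext => j /=; case: ifP. Qed.

Lemma feval_hcons (L : nLieType K n) (f : X -> L) v (x : 'I_n -> free_nlie) :
  feval f \o hcons v x = hcons (feval f v) (feval f \o x).
Proof. by apply/funext => j; rewrite /hcons /=; case: ifP. Qed.

Fact fbrk_linear i (x : 'I_n -> free_nlie) :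
  linear (fun v => fbrk [eta x with i |-> v]).
Proof.
move=> a u v; apply: feval_inj => L f.
rewrite [RHS]linearP /= !feval_brk !feval_upd [feval f (_ + _)]linearP.
exact: brk_linear.
Qed.

Fact fbrk_alternating (x : 'I_n -> free_nlie) i j :
  i != j -> x i = x j -> fbrk x = 0.
Proof.
move=> ij xij; apply: feval_inj => L f; rewrite feval_brk linear0.
by apply: (brk_alternating _ _ _ ij) => /=; rewrite xij.
Qed.

Fact fbrk_fundamental (x y : 'I_n -> free_nlie) :
  fbrk (hcons (fbrk x) y) =
  \sum_(i < n) fbrk [eta x with i |-> fbrk (hcons (x i) y)].
Proof.
apply: feval_inj => L f.
rewrite feval_brk feval_hcons feval_brk brk_fundamental raddf_sum.
by apply: eq_bigr => i _; rewrite /= feval_brk feval_upd feval_brk feval_hcons.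
Qed.

HB.instance Definition _ := isNLie.Build K n free_nlie
  fbrk_linear fbrk_alternating fbrk_fundamental.

Lemma free_nlieP : is_free fvar.
Proof.
move=> L f; split.
  by exists (feval f) => x; [exact: feval_brk|exact: feval_var].
move=> phi psi phiM psiM phipsi u.
have pi0 : fpi NZero = 0 by [].
have piD s t : fpi (NAdd s t) = fpi s + fpi t.
  by apply: feval_inj => M g; rewrite linearD /= !feval_pi.
have piZ a t : fpi (NScale a t) = a *: fpi t.
  by apply: feval_inj => M g; rewrite linearZ /= !feval_pi.
have piB ts : fpi (NBrk ts) = brk (fun i => fpi (ts i)).
  apply: feval_inj => M g; rewrite feval_brk feval_pi /=.
  by apply: brk_eq => i /=; rewrite feval_pi.
rewrite -[u]reprK -[\pi _]/(fpi (frepr u)).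
elim: (frepr u) => {u} [x||s IHs t IHt|a t IHt|ts IHts].
- exact: phipsi.
- by rewrite pi0 !linear0.
- by rewrite piD !linearD IHs IHt.
- by rewrite piZ !linearZ /= IHt.
- by rewrite piB phiM psiM; apply: brk_eq => i /=; exact: IHts.
Qed.

End FreeNLie.

Section AbelianNLie.
Variables (K : fieldType) (n k : nat).

(* A(k) *)
Definition abelian_nlie : Type := 'rV[K]_k.

HB.instance Definition _ := GRing.Lmodule.on abelian_nlie.

Definition zero_brk (x : 'I_n -> abelian_nlie) : abelian_nlie := 0.

Fact zero_brk_linear i (x : 'I_n -> abelian_nlie) :
  linear (fun v => zero_brk [eta x with i |-> v]).
Proof. by move=> a u v; rewrite scaler0 addr0. Qed.

Fact zero_brk_alternating (x : 'I_n -> abelian_nlie) (i j : 'I_n) :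
  i != j -> x i = x j -> zero_brk x = 0.
Proof. by []. Qed.

Fact zero_brk_fundamental (x y : 'I_n -> abelian_nlie) :
  zero_brk (hcons (zero_brk x) y) =
  \sum_(i < n) zero_brk [eta x with i |-> zero_brk (hcons (x i) y)].
Proof. by rewrite big1. Qed.

HB.instance Definition _ := isNLie.Build K n abelian_nlie
  zero_brk_linear zero_brk_alternating zero_brk_fundamental.

End AbelianNLie.

Definition heisenberg (K : fieldType) (n : nat) (L : nLieType K n) : Prop :=
  lcs L 2 =i center L /\ has_dim (sub_nlie (lcs L 2)) 1.

(* gamma_3(R, F, ..., F) = [[R, F, ..., F], F, ..., F] *)
Definition gamma3 (K : fieldType) (n : nat) (F : nLieType K n) (R : nideal F) :
  nideal F := lprod (lprod R).

Lemma gamma3_sub (K : fieldType) (n : nat) (F : nLieType K n) (R : nideal F) :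
  (0 < n)%N -> {subset gamma3 R <= meet_subalg R (lcs F 3)}.
Proof.
move=> n_gt0 u uG; apply/andP; split.
  by do 2 apply: lprod_subset => //.
by move: u uG; do 2 apply: lprodS.
Qed.

(* The 2-nilpotent multiplier of F / R, computed from the presentation (F, R). *)
Definition multiplier2 (K : fieldType) (n : nat) (F : nLieType K n)
    (R : nideal F) : nLieType K n :=
  subquot (meet_subalg R (lcs F 3)) (gamma3 R).

(* l_d^n(w): the basic commutators of weight w on d letters form a basis of
   F^w / F^(w+1) for F free on d letters, so they are counted by its dimension.
   The value is 0 if that quotient is infinite-dimensional. *)
Definition basic_commutator_count (K : fieldType) (n d w : nat) : nat :=
  let F : nLieType K n := free_nlie K n 'I_d in
  xget 0%N [set k | has_dim (subquot (lcs F w) (lcs F w.+1)) k].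

(* Main.v *)
From HB Require Import structures.
Require Import Defs.
From mathcomp Require Import all_boot all_order all_algebra perm.
From mathcomp Require Import boolp classical_sets.

Set Implicit Arguments.
Unset Strict Implicit.
Unset Printing Implicit Defensive.

Import GRing.Theory.
Local Open Scope ring_scope.

(** Let d = mn, let z span H^2 and let S be the preimage of H^2 in F, so that
    F/S is the abelianisation of H, of dimension d. Since H has class two,
    R \cap F^3 = F^3, and everything rests on two facts.

    First, [S, F, ..., F] = [R, F, ..., F] ([lprod_preim_derived]), hence
    gamma_3(S) = gamma_3(R). As S is spanned modulo R by a lift
    u = [x_1, ..., x_n] of z, the point is that every bracket with entry u lies
    in [R, F, ..., F]. No normal form of H enters: the bracket of H is an
    arbitrary nondegenerate alternating n-form on the d-dimensional space
    H/Z(H). As d > n, some v in F has a noncentral image in H, and yet each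
    [x_1, ..., v, ..., x_n] lies in R. Expanding the bracket of this element of
    R with well chosen entries by the fundamental identity isolates a nonzero
    multiple of [x_1, ..., u, ..., x_n], for each position of u
    ([brk_commutator_lprod]); the fundamental identity also reduces all brackets
    with entry u to these.

    Second, let G be free on d letters. Lifting a basis of H/H^2 gives a
    morphism phi from G to F, and reading the coordinates in that basis gives a
    morphism psi from F to G. The composites are the identity modulo S and
    modulo G^2 respectively, and an endomorphism which is the identity modulo an
    ideal I is the identity modulo gamma_3(I) on elements of weight three
    ([morph_congr_lcs3]). So F^3 / gamma_3(S) is isomorphic to
    G^3 / gamma_3(G^2) = G^3 / G^4. This space is spanned by the finitely many
    double brackets of letters, so its dimension is a genuine one, namely
    l_d^n(3), and brackets vanish in F^3 / gamma_3(R). *)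

(** * Brackets and spans *)

Section Bracket.
Variables (K : fieldType) (n : nat) (L : nLieType K n).
Implicit Types (x y w : 'I_n -> L) (i j k : 'I_n) (Q : {pred L}).

Lemma brk_upd0 x i : brk [eta x with i |-> 0] = 0.
Proof. by have := brk_updB x i 0 0; rewrite !subrr. Qed.

Lemma brk_updZ x i a v :
  brk [eta x with i |-> a *: v] = a *: brk [eta x with i |-> v].
Proof. by have := brk_linear i x a v 0; rewrite brk_upd0 !addr0. Qed.

Lemma brk_updN x i v : brk [eta x with i |-> - v] = - brk [eta x with i |-> v].
Proof. by rewrite -scaleN1r brk_updZ scaleN1r. Qed.

Lemma brk_upd_sum x i (I : Type) (r : seq I) (F : I -> L) :
  brk [eta x with i |-> \sum_(j <- r) F j] =
  \sum_(j <- r) brk [eta x with i |-> F j].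
Proof.
by rewrite (big_morph _ (brk_updD x i) (brk_upd0 x i)).
Qed.

Lemma upd_id x i : [eta x with i |-> x i] =1 x.
Proof. by move=> j /=; case: eqVneq => [->|]. Qed.

(** The axiom nests a bracket in the first position; skew-symmetry moves it to
    any position, and the two signs cancel. *)
Lemma brk_fundamental_at w x k :
  brk [eta w with k |-> brk x] =
  \sum_(l < n) brk [eta x with l |-> brk [eta w with k |-> x l]].
Proof.
pose o := Ordinal (leq_ltn_trans (leq0n k) (ltn_ord k)).
have [ok|ok] := eqVneq o k.
  have upd_hcons a : brk [eta w with k |-> a] = brk (hcons a w).
    by apply: brk_eq => j; rewrite /hcons /= -ok.
  rewrite upd_hcons brk_fundamental; apply: eq_bigr => l _.
  by rewrite upd_hcons.
have upd_hcons a :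
    brk [eta w with k |-> a] = - brk (hcons a (w \o tperm o k)).
  rewrite -(brk_swap _ ok); apply: brk_eq => j; rewrite /hcons /=.
  rewrite -[_ == 0%N]/(tperm o k j == o) tpermK.
  by case: tpermP => [->|->|/eqP/negPf-> /eqP/negPf->];
    rewrite ?eqxx // (eq_sym k) (negPf ok) ?(negPf ok).
rewrite upd_hcons brk_fundamental -sumrN; apply: eq_bigr => l _.
by rewrite upd_hcons brk_updN.
Qed.

Lemma submod_closed_preim_brk Q x i :
  submod_closed Q -> submod_closed [pred v | brk [eta x with i |-> v] \in Q].
Proof.
move=> [Q0 QD]; split=> [|a u v uQ vQ]; rewrite inE; last first.
  by rewrite brk_linear; exact: QD.
by rewrite brk_upd0.
Qed.

(** The entries of x are replaced by those of y one at a time, so the other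
    entries of each intermediate bracket come from either tuple. *)
Lemma brk_telescope Q x y :
    zmod_closed Q ->
    (forall w i, (forall j, w j = x j \/ w j = y j) ->
       brk [eta w with i |-> y i - x i] \in Q) ->
  brk y - brk x \in Q.
Proof.
move=> [Q0 QB] Qstep.
have QD u v : u \in Q -> v \in Q -> u + v \in Q.
  by move=> uQ vQ; rewrite -[v]opprK QB // -[- v]sub0r QB.
pose z (k : nat) : 'I_n -> L := fun i => if (i < k)%N then y i else x i.
suff zP (k : nat) : (k <= n)%N -> brk (z k) - brk x \in Q.
  have := zP n (leqnn n); congr (_ - _ \in Q).
  by apply: brk_eq => i; rewrite /z ltn_ord.
elim: k => [|k IHk] kn.
  by rewrite (_ : brk (z 0%N) = brk x) ?subrr //; apply: brk_eq.
pose o := Ordinal kn.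
rewrite -(subrK (brk (z k)) (brk (z k.+1))) -addrA QD ?IHk ?(ltnW kn) //.
have zk : brk (z k) = brk [eta z k with o |-> x o].
  by apply: brk_eq => i /=; case: eqVneq => [->|//]; rewrite /z ltnn.
have zk1 : brk (z k.+1) = brk [eta z k with o |-> y o].
  apply: brk_eq => i /=; case: eqVneq => [->|io]; first by rewrite /z ltnSn.
  by rewrite /z ltnS leq_eqVlt -[_ == k :> nat]/(i == o) (negPf io).
rewrite zk zk1 -brk_updB; apply: Qstep => j; rewrite /z.
by case: ifP; [right | left].
Qed.

End Bracket.

Section Span.
Variables (K : fieldType) (V : lmodType K).

(** The intersection of the submodules containing B: bracket conditions on one
    entry define submodules, which can then be tested on B. *)
Definition span_of (B : set V) : {pred V} := fun v =>
  `[< forall Q : {pred V}, submod_closed Q -> (forall b, B b -> b \in Q) ->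
        v \in Q >].

Lemma span_min (B : set V) (Q : {pred V}) :
  submod_closed Q -> (forall b, B b -> b \in Q) -> {subset span_of B <= Q}.
Proof. by move=> QM BQ v /asboolP; exact. Qed.

Lemma span_gen (B : set V) b : B b -> b \in span_of B.
Proof. by move=> Bb; apply/asboolP => Q _; exact. Qed.

Lemma span_submod (B : set V) : submod_closed (span_of B).
Proof.
split=> [|a u v /asboolP uB /asboolP vB]; apply/asboolP => Q QM BQ.
  by case: QM.
by case: (QM) => _ QD; apply: QD; [exact: uB | exact: vB].
Qed.

End Span.

Lemma submod_closed_preim (K : fieldType) (V W : lmodType K)
    (f : {linear V -> W}) (Q : {pred W}) :
  submod_closed Q -> submod_closed [pred v | f v \in Q].
Proof.
move=> [Q0 QD]; split=> [|a u v uQ vQ]; rewrite inE ?linear0 //.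
by rewrite linearP; exact: QD.
Qed.

Section Products.
Variables (K : fieldType) (n : nat) (L : nLieType K n).
Implicit Types (x y w : 'I_n -> L) (i j k : 'I_n) (I : nideal L).

(** Multilinearity: the entries are released from the spanning sets to the spans
    one position at a time. *)
Lemma brk_span (B : 'I_n -> set L) (Q : {pred L}) :
    submod_closed Q -> (forall x, (forall i, B i (x i)) -> brk x \in Q) ->
  forall x, (forall i, x i \in span_of (B i)) -> brk x \in Q.
Proof.
move=> QM BQ x xB.
suff kP (k : nat) : (k <= n)%N -> forall y, (forall i, y i \in span_of (B i)) ->
    (forall i, (k <= i)%N -> B i (y i)) -> brk y \in Q.
  by apply: (kP n) => // i; rewrite leqNgt ltn_ord.
elim: k => [|k IHk] kn y yB ykB; first by apply: BQ => i; exact: ykB.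
pose o := Ordinal kn; rewrite -(brk_eq (upd_id y o)).
apply: (span_min (submod_closed_preim_brk y o QM) _ (yB o)) => b Bb.
rewrite inE; apply: IHk => [|i /=|i /= ki]; first exact: ltnW.
  by case: eqVneq => [->|//]; exact: span_gen.
case: eqVneq => [->//|io]; apply: ykB.
by rewrite ltn_neqAle ki andbT eq_sym -[_ == k]/(i == o) io.
Qed.

Lemma lprod_mem I x i : x i \in I -> brk x \in lprod I.
Proof.
pose o := Ordinal (leq_ltn_trans (leq0n i) (ltn_ord i)).
have o0 : o = 0 :> nat by [].
have [->|io] := eqVneq i o; first exact: lprod_gen.
move=> xI; rewrite -[brk x]opprK -(brk_swap x io) rpredN.
by apply: (lprod_gen o0) => /=; rewrite tpermR.
Qed.

(** Although [I, L, ..., L] is a generated subalgebra, it is already the linear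
    span of the brackets with first entry in I, because these brackets lie in
    I themselves. *)
Lemma lprod_ind I (Q : {pred L}) (o : 'I_n) : o = 0 :> nat ->
    submod_closed Q -> (forall x, x o \in I -> brk x \in Q) ->
  {subset lprod I <= Q}.
Proof.
move=> o0 QM IQ.
have AM : submod_closed [predI lprod I & Q].
  split=> [|a u w /andP[uI uQ] /andP[wI wQ]].
    by rewrite inE rpred0; case: QM.
  by rewrite inE rpredD ?rpredZ //; case: QM => _; apply.
have AB x : (forall i, x i \in [predI lprod I & Q]) ->
    brk x \in [predI lprod I & Q].
  move=> xA; have /andP[xoI _] := xA o; have {}xoI := lprod_sub o0 xoI.
  by rewrite inE (lprod_mem xoI) IQ.
suff sub : {subset lprod I <= NSubalg AM AB} by move=> v /sub /andP[].
apply: gen_min => _ [x xI <-]; have := xI o; rewrite /hcons o0 /= => xoI.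
by rewrite inE /= IQ // andbT (lprod_mem xoI).
Qed.

Lemma lprod_eq0 I (o : 'I_n) : o = 0 :> nat ->
    (forall x, x o \in I -> brk x = 0) ->
  forall v, v \in lprod I -> v = 0.
Proof.
move=> o0 I0 v vI; apply/eqP; rewrite -[_ == _]/(v \in pred1 (0 : L)).
apply: (lprod_ind o0 _ _ vI) => [|x /I0->]; last exact: eqxx.
split=> [|a u w /eqP-> /eqP->]; first exact: eqxx.
by rewrite scaler0 addr0 inE.
Qed.

(** Expanding the element of L^2 by the fundamental identity puts the entry
    taken from I two brackets deep. *)
Lemma brk_lcs2_ideal I x i j :
  i != j -> x i \in lcs L 2 -> x j \in I -> brk x \in gamma3 I.
Proof.
move=> ij xi xj; rewrite -(brk_eq (upd_id x i)).
pose o := Ordinal (leq_ltn_trans (leq0n i) (ltn_ord i)).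
have o0 : o = 0 :> nat by [].
have QM := submod_closed_preim_brk x i (nsubalg_submod (gamma3 I)).
apply: (lprod_ind o0 QM _ xi).
move=> w _; rewrite -[_ \in _]/(brk _ \in lprod (lprod I)).
rewrite brk_fundamental_at; apply: rpred_sum => l _.
apply: (lprod_mem (i := l)); rewrite /= eqxx; apply: (lprod_mem (i := j)).
by rewrite /= eq_sym (negPf ij).
Qed.

End Products.

(** * Morphisms and free algebras *)

Section Morphisms.
Variables (K : fieldType) (n : nat).
Hypothesis n_gt0 : (0 < n)%N.
Let o : 'I_n := Ordinal n_gt0.

Lemma morph_lprod (L M : nLieType K n) (f : {linear L -> M})
    (I : nideal L) (J : nideal M) : nlie_morphism f ->
  (forall v, v \in I -> f v \in J) ->
  forall v, v \in lprod I -> f v \in lprod J.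
Proof.
move=> fM fIJ v vI; apply: (@lprod_ind _ _ _ I [pred v | f v \in lprod J] o).
- by [].
- exact/submod_closed_preim/nsubalg_submod.
- move=> x xI; rewrite -[_ \in _]/(f _ \in lprod J) fM.
  apply: (lprod_mem (i := o)); exact: fIJ.
- exact: vI.
Qed.

Lemma morph_lcs (L M : nLieType K n) (f : {linear L -> M}) i :
  nlie_morphism f -> forall v, v \in lcs L i -> f v \in lcs M i.
Proof. by move=> fM; rewrite /lcs; elim: i.-1 => //= k; exact: morph_lprod. Qed.

(** An endomorphism that is the identity modulo S moves a bracket by
    brackets with one entry in S; in weight three, the entry displaced by S
    sits either inside the inner bracket, or next to it, and then
    [brk_lcs2_ideal] applies. *)
Lemma morph_congr_lcs3 (L : nLieType K n) (f : {linear L -> L})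
    (S : nideal L) : nlie_morphism f ->
    (forall v, f v - v \in S) ->
  forall v, v \in lcs L 3 -> f v - v \in gamma3 S.
Proof.
move=> fM fS.
have diffM (I : nideal L) : submod_closed [pred v | f v - v \in I].
  exact: (submod_closed_preim (f \- idfun : {linear L -> L})
    (nsubalg_submod I)).
have idealB (I : nideal L) : zmod_closed I.
  by split=> [|u v uI vI]; rewrite ?rpred0 ?rpredB.
have f2 v : v \in lcs L 2 -> f v - v \in lprod S.
  apply: (lprod_ind (o := o) _ (diffM (lprod S))) => // x _.
  rewrite -[_ \in _]/(f _ - _ \in lprod S) fM.
  apply: brk_telescope (idealB (lprod S)) _ => w i _.
  by apply: (lprod_mem (i := i)); rewrite /= eqxx.
apply: (lprod_ind (o := o) _ (diffM (gamma3 S))) => // x xo.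
rewrite -[_ \in _]/(f _ - _ \in gamma3 S) fM.
apply: brk_telescope (idealB (gamma3 S)) _ => w i wE.
have [->|oi] := eqVneq i o.
  by apply: (lprod_mem (i := o)); exact: f2.
apply: (brk_lcs2_ideal (i := o) (j := i)); rewrite 1?eq_sym //=; last first.
  by rewrite eqxx.
rewrite eq_sym (negPf oi).
by case: (wE o) => -> //; exact: (morph_lcs (i := 2) fM xo).
Qed.

(** The universal property lifts the letters to A; following the lift by the
    inclusion of A is then the identity. *)
Lemma free_generated (X : Type) (F : nLieType K n) (iota : X -> F)
    (A : nsubalg F) : is_free iota ->
  (forall t, iota t \in A) -> forall v, v \in A.
Proof.
move=> F_free iA v.
have [[g gM gE] _] := F_free (sub_nlie A) (fun t => SubNLie (iA t)).
have [_ uniq] := F_free F iota.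
pose h : {linear F -> F} := (val : sub_nlie A -> F) \o g.
have hM : nlie_morphism h by move=> x; rewrite /h /= gM.
have idM : nlie_morphism (idfun : {linear F -> F}) by [].
have hid : h =1 idfun by apply: uniq => // t; rewrite /h /= gE.
by rewrite -[v]/(idfun v) -hid; exact: (valP (g v)).
Qed.

End Morphisms.

(** The elements on which f and g agree modulo I form a subalgebra, because f
    and g map all brackets into I. *)
Lemma free_morph_congr (K : fieldType) (n : nat) (X : Type) (L M : nLieType K n)
    (iota : X -> L) (f g : {linear L -> M}) (I : nideal M) :
    is_free iota ->
    (forall x, f (brk x) \in I) -> (forall x, g (brk x) \in I) ->
    (forall t, f (iota t) - g (iota t) \in I) ->
  forall v, f v - g v \in I.
Proof.
move=> L_free f_brk g_brk fg_iota v.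
have fgM := submod_closed_preim (f \- g : {linear L -> M}) (nsubalg_submod I).
have fg_brk (x : 'I_n -> L) : (forall i, x i \in [pred v | (f \- g) v \in I]) ->
    brk x \in [pred v | (f \- g) v \in I].
  by move=> _; rewrite -[_ \in _]/(f (brk x) - g (brk x) \in I) rpredB.
pose A : nsubalg L := NSubalg fgM fg_brk.
exact: (free_generated (A := A) L_free fg_iota v).
Qed.

Section PreimageIdeal.
Variables (K : fieldType) (n : nat) (L M : nLieType K n).
Variables (f : {linear L -> M}) (fM : nlie_morphism f) (I : nideal M).

Let preim : {pred L} := [pred v | f v \in I].

Fact preim_brk (x : 'I_n -> L) (i : 'I_n) : x i \in preim -> brk x \in preim.
Proof.
move=> xi; rewrite -[_ \in _]/(f (brk x) \in I) fM.
exact: (nideal_brk (i := i)).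
Qed.

Fact preim_brk_all (x : 'I_n -> L) :
  (forall i, x i \in preim) -> brk x \in preim.
Proof.
move=> xI; rewrite -[_ \in _]/(f (brk x) \in I) fM.
exact: nsubalg_brk.
Qed.

Definition preim_ideal : nideal L :=
  @NIdeal _ _ _
    (NSubalg (submod_closed_preim f (nsubalg_submod I)) preim_brk_all)
    preim_brk.

End PreimageIdeal.

(** * Finite dimension *)

Section LinComb.
Variables (K : fieldType) (V : lmodType K) (d : nat) (e : 'I_d -> V).

Definition lincomb (r : 'rV[K]_d) : V := \sum_j r 0 j *: e j.

Fact lincomb_linear : linear lincomb.
Proof.
move=> a r s; rewrite scaler_sumr -big_split; apply: eq_bigr => j _.
by rewrite !mxE scalerDl scalerA.
Qed.

HB.instance Definition _ :=
  GRing.isLinear.Build K 'rV[K]_d V *:%R lincomb lincomb_linear.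

Lemma lincomb_delta j : lincomb (delta_mx 0 j) = e j.
Proof.
rewrite /lincomb (bigD1 j) //= mxE !eqxx scale1r big1 ?addr0 // => i ij.
by rewrite mxE eqxx (negPf ij) scale0r.
Qed.

End LinComb.

(** Induction on the length of the family: either it is free, and coordinates
    give the isomorphism with row vectors, or one of its members is redundant. *)
Lemma has_dim_of_span_ord (K : fieldType) (V : lmodType K) (N : nat)
    (e : 'I_N -> V) :
  (forall v, exists c : 'I_N -> K, v = \sum_(i < N) c i *: e i) ->
  exists k, has_dim V k.
Proof.
elim: N e => [|N IHN] e eV.
  exists 0%N; constructor; exists (fun=> 0).
    by move=> a u v; rewrite scaler0 addr0.
  exists (fun=> 0) => [v|r]; first by have [c ->] := eV v; rewrite big_ord0.
  by apply/rowP => -[].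
have [e_free|] := pselect (forall c : 'I_N.+1 -> K,
    \sum_(i < N.+1) c i *: e i = 0 -> forall i, c i = 0).
  have [c cE] := choice eV.
  have c_uniq b v : v = \sum_(i < N.+1) b i *: e i -> c v = b.
    move=> vE; apply/funext => i; apply/eqP; rewrite -subr_eq0; apply/eqP.
    move: i; apply: (e_free (fun i => c v i - b i)).
    under eq_bigr => i _ do rewrite scalerBl.
    by rewrite sumrB -cE -vE subrr.
  exists N.+1; constructor; exists (fun v => \row_i c v i).
    move=> a u v; apply/rowP => i; rewrite !mxE.
    rewrite (c_uniq (fun i => a * c u i + c v i)) //.
    under eq_bigr => j _ do rewrite scalerDl -scalerA.
    by rewrite big_split -scaler_sumr -!cE.
  exists (fun r : 'rV_N.+1 => \sum_(i < N.+1) r 0 i *: e i) => [v|r].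
    by rewrite [RHS]cE; apply: eq_bigr => i _; rewrite mxE.
  by apply/rowP => i; rewrite mxE (c_uniq (r 0)).
move=> /existsNP[b /not_implyP[bE /existsNP[i /eqP bi]]].
apply: (IHN (e \o lift i)) => v; have [c cE] := eV v.
(* A relation with nonzero coefficient at i eliminates e i. *)
exists (fun j => c (lift i j) - c i / b i * b (lift i j)).
have -> : v = \sum_(j < N.+1) (c j - c i / b i * b j) *: e j.
  under eq_bigr => j _ do rewrite scalerBl -scalerA.
  by rewrite sumrB -scaler_sumr bE scaler0 subr0.
by rewrite (bigD1_ord i) //= divfK // subrr scale0r add0r.
Qed.

Lemma has_dim_of_span (K : fieldType) (V : lmodType K) (T : finType)
    (e : T -> V) :
  (forall v, exists c : T -> K, v = \sum_t c t *: e t) ->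
  exists k, has_dim V k.
Proof.
move=> eV; apply: (@has_dim_of_span_ord _ _ #|T| (e \o enum_val)) => v.
have [c ->] := eV v; exists (c \o enum_val).
exact: (reindex _ (onW_bij _ (enum_val_bij T))).
Qed.

(** * Subquotients *)

Section SubquotMap.
Variables (K : fieldType) (n : nat) (L M : nLieType K n).
Variables (A : nsubalg L) (I : nideal L) (B : nsubalg M) (J : nideal M).
Variable f : {linear L -> M}.
Hypothesis fAB : forall v, v \in A -> f v \in B.
Hypothesis fIJ : forall v, v \in A -> v \in I -> f v \in J.

(** Defined through representatives, hence independent of their choice, and
    linear, only if f maps the part of I in A into J. *)
Definition subquot_map (q : subquot A I) : subquot B J :=
  quot_pi (trace_ideal B J) (SubNLie (fAB (valP (quot_repr q)))).

Lemma subquot_map_pi (a : sub_nlie A) (b : sub_nlie B) :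
  f (sub_val a) - sub_val b \in J ->
  subquot_map (quot_pi (trace_ideal A I) a) = quot_pi (trace_ideal B J) b.
Proof.
move=> fab; apply/quot_piP; set a' := quot_repr _.
have aa' : sub_val a' - sub_val a \in I.
  by apply/(@quot_piP _ _ _ (trace_ideal A I)); rewrite quot_reprK.
rewrite -[_ \in _]/(f (sub_val a') - sub_val b \in J).
rewrite -(subrK (f (sub_val a)) (f _)) -linearB -addrA rpredD //.
by apply: fIJ aa'; rewrite rpredB //; exact: valP.
Qed.

Lemma subquot_map_linear : linear subquot_map.
Proof.
move=> c u v; rewrite -[u]quot_reprK -[v]quot_reprK -linearP.
set a := quot_repr u; set b := quot_repr v.
rewrite (@subquot_map_pi a (SubNLie (fAB (valP a)))) ?subrr ?rpred0 //.
rewrite (@subquot_map_pi b (SubNLie (fAB (valP b)))) ?subrr ?rpred0 //.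
rewrite -linearP; apply: subquot_map_pi => /=.
by rewrite linearP subrr rpred0.
Qed.

End SubquotMap.

Lemma subquot_mapK (K : fieldType) (n : nat) (L M : nLieType K n)
    (A : nsubalg L) (I : nideal L) (B : nsubalg M) (J : nideal M)
    (f : {linear L -> M}) (g : {linear M -> L})
    (fAB : forall v, v \in A -> f v \in B)
    (gBA : forall v, v \in B -> g v \in A)
    (gJI : forall v, v \in B -> v \in J -> g v \in I) :
    (forall v, v \in A -> g (f v) - v \in I) ->
  cancel (@subquot_map _ _ _ _ A I B J f fAB)
         (@subquot_map _ _ _ _ B J A I g gBA).
Proof.
move=> gf q; rewrite -[RHS]quot_reprK; apply: subquot_map_pi => //.
exact: gf (valP (quot_repr q)).
Qed.

Lemma subquot_brk_eq0 (K : fieldType) (n : nat) (L : nLieType K n)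
    (A : nsubalg L) (I : nideal L) :
    (forall y : 'I_n -> L, (forall i, y i \in A) -> brk y \in I) ->
  forall x : 'I_n -> subquot A I, brk x = 0.
Proof.
move=> AI x; rewrite -[RHS](linear0 (quot_pi (trace_ideal A I))).
apply/quot_piP; rewrite subr0; apply: AI => i.
exact: valP (quot_repr (x i)).
Qed.

(** * The third layer of a free algebra *)

Section FreeLayer.
Variables (K : fieldType) (n : nat).
Hypothesis n_gt0 : (0 < n)%N.
Let o : 'I_n := Ordinal n_gt0.

(** Modulo G^2 the letters span G, modulo G^3 their brackets span G^2, and
    modulo G^4 the double brackets span G^3: a bracket having an entry of one
    weight too many is absorbed by the next term of the series. For an entry of
    G^2 next to another one, this is [brk_lcs2_ideal]. *)
Lemma free_lcs3_finite (d : nat) (G : nLieType K n) (g : 'I_d -> G) :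
  is_free g -> exists k, has_dim (subquot (lcs G 3) (lcs G 4)) k.
Proof.
move=> G_free.
pose B1 : set G := [set v | (exists i, v = g i) \/ v \in lcs G 2]%classic.
pose B2 : set G :=
  [set v | (exists f : {ffun 'I_n -> 'I_d}, v = brk (g \o f)) \/
           v \in lcs G 3]%classic.
have GB1 v : v \in span_of B1.
  have AB x : (forall i, x i \in span_of B1) -> brk x \in span_of B1.
    by move=> _; apply: span_gen; right; exact: (lprod_mem (i := o)).
  apply: (free_generated (A := NSubalg (span_submod B1) AB) G_free).
  by move=> t; apply: span_gen; left; exists t.
have G2B2 v : v \in lcs G 2 -> v \in span_of B2.
  apply: (lprod_ind (o := o) _ (span_submod B2)) => // x _.
  apply: (brk_span (B := fun=> B1) (span_submod B2)) => // {}x xB1.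
  apply: span_gen; have [[i xi]|xG] := pselect (exists i, x i \in lcs G 2).
    by right; exact: (lprod_mem xi).
  have /choice[f fE] i : exists j, x i = g j.
    by case: (xB1 i) => // xi; case: xG; exists i.
  by left; exists (finfun f); apply: brk_eq => i /=; rewrite ffunE.
pose T : finType := ({ffun 'I_n -> 'I_d} * {ffun 'I_n -> 'I_d})%type.
(* The entry of t.2 at o is overwritten, which only repeats members. *)
pose e (t : T) : G := brk [eta (g \o t.2) with o |-> brk (g \o t.1)].
have eG t : e t \in lcs G 3.
  by apply: (lprod_mem (i := o)); exact: (lprod_mem (i := o)).
pose Q : {pred G} :=
  fun v => `[< exists c : T -> K, v - \sum_t c t *: e t \in lcs G 4 >].
have QM : submod_closed Q.
  split=> [|a u v /asboolP[b uE] /asboolP[c vE]]; apply/asboolP.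
    exists (fun=> 0); rewrite big1 ?subr0 ?rpred0 // => t _.
    by rewrite scale0r.
  exists (fun t => a * b t + c t).
  under eq_bigr => t _ do rewrite scalerDl -scalerA.
  by rewrite big_split -scaler_sumr opprD addrACA -scalerBr rpredD ?rpredZ.
have QG4 v : v \in lcs G 4 -> v \in Q.
  move=> vG; apply/asboolP; exists (fun=> 0).
  by rewrite big1 ?subr0 // => t _; rewrite scale0r.
have G3Q v : v \in lcs G 3 -> v \in Q.
  apply: (lprod_ind (o := o) _ QM) => // x xo.
  apply: (brk_span (B := fun i => if i == o then B2 else B1) QM); last first.
    by move=> i; case: eqP => [->|_]; [exact: G2B2 | exact: GB1].
  move=> {xo}x xB; have [[f xo]|xo] : B2 (x o) by have := xB o; rewrite ?eqxx.
    2: by apply: QG4; exact: (lprod_mem (i := o)).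
  have xoG : x o \in lcs G 2 by rewrite xo; exact: (lprod_mem (i := o)).
  have [[i io xi]|xG] := pselect (exists2 i, i != o & x i \in lcs G 2).
    apply: QG4; apply: (brk_lcs2_ideal (i := o) _ xoG xi).
    by rewrite eq_sym.
  have /choice[h hE] i : exists j, i = o \/ x i = g j.
    have [->|io] := eqVneq i o.
      have j : 'I_d by exact: f o.
      by exists j; left.
    have := xB i; rewrite (negPf io) => -[[j ->]|xi]; first by exists j; right.
    by case: xG; exists i.
  apply/asboolP; exists (fun t => ((f, finfun h) == t)%:R).
  have -> : \sum_t ((f, finfun h) == t)%:R *: e t = brk x.
    rewrite (bigD1 (f, finfun h)) //= eqxx scale1r big1 => [|t]; last first.
      by rewrite eq_sym => /negPf->; rewrite scale0r.
    rewrite addr0; apply: brk_eq => i /=; case: eqVneq => [->//|/eqP io].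
    by rewrite ffunE; case: (hE i).
  by rewrite subrr rpred0.
pose cls t : subquot (lcs G 3) (lcs G 4) :=
  quot_pi (trace_ideal (lcs G 3) (lcs G 4)) (SubNLie (eG t)).
apply: (has_dim_of_span (e := cls)) => q.
have /asboolP[c cE] := G3Q _ (valP (quot_repr q)).
exists c; rewrite -[q]quot_reprK.
have -> : \sum_t c t *: cls t = quot_pi (trace_ideal (lcs G 3) (lcs G 4))
    (\sum_t c t *: SubNLie (eG t)).
  by rewrite linear_sum; apply: eq_bigr => t _; rewrite linearZ.
apply/quot_piP; rewrite -[_ \in _]/(val (quot_repr q - _) \in lcs G 4).
rewrite linearB linear_sum; move: cE; congr (_ - _ \in lcs G 4).
Qed.

End FreeLayer.

Lemma free_lcs3_dim (K : fieldType) (n : nat) (n_gt0 : (0 < n)%N) (d : nat) :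
  exists (G : nLieType K n) (g : 'I_d -> G), is_free g /\
    has_dim (subquot (lcs G 3) (lcs G 4)) (basic_commutator_count K n d 3).
Proof.
exists (free_nlie K n 'I_d), (@fvar K n 'I_d); split; first exact: free_nlieP.
pose P : set nat := fun k => has_dim
  (subquot (lcs (free_nlie K n 'I_d) 3) (lcs (free_nlie K n 'I_d) 4)) k.
apply: (@xgetPex _ 0%N P).
exact: (free_lcs3_finite n_gt0 (@free_nlieP K n 'I_d)).
Qed.

(** * Heisenberg algebras *)

(** The vectors b are a basis of a complement of the line of z, and c gives the
    coordinates modulo z in it. *)
Lemma complement_line (K : fieldType) (V : lmodType K) (d : nat) (z : V) :
    has_dim V d.+1 -> z != 0 ->
  exists (c : {linear V -> 'rV[K]_d}) (b : 'I_d -> V),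
    [/\ c z = 0, forall j, c (b j) = delta_mx 0 j &
        forall v, exists a, v = \sum_j c v 0 j *: b j + a *: z].
Proof.
move=> [[r r_lin [g rK gK]]] z0.
pose rM := GRing.isLinear.Build _ _ _ _ r r_lin.
pose rL : {linear V -> 'rV[K]_d.+1} := HB.pack r rM.
have [k zk] : exists k, r z 0 k != 0.
  apply/existsP; rewrite -negb_forall; apply: contraNN z0 => /forallP rz.
  rewrite -[z]rK (_ : r z = r 0) ?rK //; apply/rowP => k.
  by rewrite -[r 0]/(rL 0) linear0 mxE; exact/eqP.
(* Subtracting a v *: z clears the k-th coordinate of v; the others remain. *)
pose a v := r v 0 k / r z 0 k.
pose cf v : 'rV[K]_d := \row_j (r v 0 (lift k j) - a v * r z 0 (lift k j)).
have c_lin : linear cf.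
  move=> s u v; apply/rowP => j; rewrite !mxE /a r_lin !mxE.
  rewrite mulrDl -mulrA mulrDl opprD mulrBr addrACA.
  by rewrite !mulrA.
pose cM := GRing.isLinear.Build _ _ _ _ cf c_lin.
pose c : {linear V -> 'rV[K]_d} := HB.pack cf cM.
exists c, (fun j => g (delta_mx 0 (lift k j))); split=> [|j|v].
- by apply/rowP => j; rewrite !mxE /a divff // mul1r subrr.
- apply/rowP => i; rewrite !mxE /a gK !mxE eqxx !andTb.
  by rewrite (negPf (neq_lift _ _)) mul0r mul0r subr0 (inj_eq lift_inj).
exists (a v); apply: (can_inj rK).
have rE u : r u = rL u by [].
rewrite (rE (_ + _)) linearD linear_sum linearZ -!rE.
apply/rowP => i; rewrite !mxE summxE.
under eq_bigr => j _ do rewrite linearZ -rE gK !mxE eqxx andTb.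
case: (unliftP k i) => [j|] ->.
  rewrite (bigD1 j) //= eqxx mulr1 big1 ?addr0 ?subrK // => j' jj'.
  by rewrite (inj_eq lift_inj) eq_sym (negPf jj') mulr0.
rewrite big1 ?add0r ?divfK // => j _.
by rewrite (negPf (neq_lift _ _)) mulr0.
Qed.

Section Heisenberg.
Variables (K : fieldType) (n : nat) (H : nLieType K n).
Hypothesis n_gt0 : (0 < n)%N.
Hypothesis H_heisenberg : heisenberg H.
Let o : 'I_n := Ordinal n_gt0.

Lemma heisenberg_derived_line : exists2 x : 'I_n -> H, brk x != 0 &
  forall h, h \in lcs H 2 -> exists a, h = a *: brk x.
Proof.
have [_ [[r r_lin [g rK gK]]]] := H_heisenberg.
pose rM := GRing.isLinear.Build _ _ _ _ r r_lin.
pose rL : {linear sub_nlie (lcs H 2) -> 'rV[K]_1} := HB.pack r rM.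
have [x x0] : exists x : 'I_n -> H, brk x != 0.
  apply: contrapT => /forallNP brk0.
  have H2_0 h : h \in lcs H 2 -> h = 0.
    apply: (lprod_eq0 (o := o)) => // x _.
    by have /negP := brk0 x; rewrite negbK => /eqP.
  have g0 : g (const_mx 1) = 0.
    by apply: val_inj; rewrite (H2_0 _ (valP (g _))) linear0.
  have := gK (const_mx 1); rewrite g0 -[r 0]/(rL 0) linear0.
  by move/rowP/(_ 0)/eqP; rewrite !mxE eq_sym oner_eq0.
exists x => // h hH.
have zH : brk x \in lcs H 2 by exact: (lprod_mem (i := o)).
pose sz : sub_nlie (lcs H 2) := SubNLie zH.
have rz : r sz 0 0 != 0.
  apply: contraNneq x0 => rz; apply/eqP.
  rewrite -[LHS]/(val sz) (_ : sz = 0) ?linear0 //; apply: (can_inj rK).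
  by apply/rowP => i; rewrite -[r 0]/(rL 0) linear0 mxE ord1.
pose sh : sub_nlie (lcs H 2) := SubNLie hH.
exists (r sh 0 0 / r sz 0 0).
suff shE : sh = (r sh 0 0 / r sz 0 0) *: sz.
  by have := congr1 val shE; rewrite linearZ.
apply: (can_inj rK); apply/rowP => i; rewrite -[r (_ *: _)]/(rL _) linearZ.
by rewrite mxE ord1 /= divfK.
Qed.

Lemma heisenberg_lcs3 h : h \in lcs H 3 -> h = 0.
Proof.
apply: (lprod_eq0 (o := o)) => // x xo; have [HZ _] := H_heisenberg.
have {xo} : x o \in lcs H 2 by [].
rewrite HZ => /asboolP xZ; rewrite -(xZ x).
apply: brk_eq => i; rewrite /hcons; case: eqP => // i0.
by congr x; apply: val_inj.
Qed.

(** The conditions on h are n linear equations on a complement of the centre,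
    which has dimension d > n. *)
Lemma heisenberg_isotropic (d : nat) (x : 'I_n -> H) :
    (n < d)%N -> has_dim H d.+1 -> brk x != 0 ->
    (forall h, h \in lcs H 2 -> exists a, h = a *: brk x) ->
  exists2 h, h \notin center H & forall i, brk [eta x with i |-> h] = 0.
Proof.
move=> nd Hd z0 H2z; have [c [b [cz cb _]]] := complement_line Hd z0.
have brkz w : exists a, brk w = a *: brk x.
  by apply: H2z; exact: (lprod_mem (i := o)).
have /choice[a aE] (ji : 'I_d * 'I_n) :
    exists a, brk [eta x with ji.2 |-> b ji.1] = a *: brk x by exact: brkz.
pose M : 'M[K]_(d, n) := \matrix_(j, i) a (j, i).
have /rowV0Pn[r /sub_kermxP rM r0] : kermx M != 0.
  rewrite kermx_eq0 /row_free neq_ltn.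
  by rewrite (leq_ltn_trans (rank_leq_col M) nd).
exists (\sum_j r 0 j *: b j) => [|i].
  have [HZ _] := H_heisenberg; rewrite -HZ.
  apply: contra r0 => /H2z[s sE]; apply/eqP.
  have cE : c (\sum_j r 0 j *: b j) = r.
    rewrite linear_sum [RHS]row_sum_delta; apply: eq_bigr => j _.
    by rewrite linearZ /= cb.
  by rewrite -cE sE linearZ /= cz scaler0.
rewrite brk_upd_sum (eq_bigr (fun j => (r 0 j * M j i) *: brk x)) => [|j _].
  rewrite -scaler_suml; move/rowP/(_ i): rM; rewrite !mxE => ->.
  exact: scale0r.
by rewrite brk_updZ (aE (j, i)) mxE scalerA.
Qed.

End Heisenberg.

(** Write u = [x_1, ..., x_n], and T_i for the bracket of x with u at position
    i. By the first hypothesis, a bracket of brackets depends, modulo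
    [R, L, ..., L], only on the coefficients of u in the inner brackets. Let x'
    be x with x_i replaced by v: its bracket is in R, so it can be placed at
    position k of w, and the resulting bracket vanishes. In its expansion by the
    fundamental identity, the i-th term is a nonzero multiple of T_i. The l-th
    term is, up to a factor, the bracket of x' with u at position l; expand this
    u in turn: up to sign, the entries of every inner bracket either are those
    of x with one of them replaced by v, or contain a repetition. Hence T_i
    vanishes for all i, and expanding u in an arbitrary bracket gives a
    combination of the T_i. *)
Lemma brk_commutator_lprod (K : fieldType) (n : nat) (L : nLieType K n)
    (R : nideal L) (x : 'I_n -> L) (v : L) :
    (forall w, exists a, brk w - a *: brk x \in R) ->
    (forall i, brk [eta x with i |-> v] \in R) ->
    (exists w k, exists2 a, a != 0 &
       brk [eta w with k |-> v] - a *: brk x \in R) ->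
  forall w k, brk [eta w with k |-> brk x] \in lprod R.
Proof.
move=> brkR vR [w0 [k0 [a0 a0_neq0 w0R]]]; set u := brk x.
have sub_mod w l b a : b - a *: u \in R ->
    brk [eta w with l |-> b] - a *: brk [eta w with l |-> u] \in lprod R.
  move=> bR; rewrite -brk_updZ -brk_updB; apply: (lprod_mem (i := l)).
  by rewrite /= eqxx.
have sub_mem w l b : brk [eta w with l |-> u] \in lprod R ->
    (exists y, b = brk y) -> brk [eta w with l |-> b] \in lprod R.
  move=> uR [y ->]; have [a /(sub_mod w l) aR] := brkR y.
  by rewrite -(subrK (a *: brk [eta w with l |-> u]) (brk _)) rpredD ?rpredZ.
have xR i : brk [eta x with i |-> u] \in lprod R.
  pose x' : 'I_n -> L := [eta x with i |-> v].
  have x'R l : l != i -> brk [eta x' with l |-> u] \in lprod R.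
    move=> li; rewrite brk_fundamental_at; apply: rpred_sum => j _.
    apply: (lprod_mem (i := j)); rewrite /= eqxx.
    have [->|jl] := eqVneq j l.
      rewrite (_ : brk _ = brk x') ?vR //; apply: brk_eq => k /=.
      by case: eqVneq => [->|//]; rewrite /x' /= (negPf li).
    have [->|ji] := eqVneq j i.
      rewrite -[brk _]opprK -(brk_swap _ li) rpredN.
      rewrite (_ : brk _ = brk [eta x with l |-> v]) ?vR //.
      apply: brk_eq => k; rewrite /x' /=.
      have il : (i == l) = false by rewrite eq_sym (negPf li).
      by case: tpermP => [->|->|/eqP/negPf-> /eqP/negPf->];
        rewrite ?eqxx ?il ?eqxx.
    rewrite (brk_alternating _ _ _ jl) ?rpred0 //.
    by rewrite /x' /= (negPf jl) (negPf ji) eqxx.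
  have : brk [eta w0 with k0 |-> brk x'] \in lprod R.
    by apply: (lprod_mem (i := k0)); rewrite /= eqxx; exact: vR.
  rewrite brk_fundamental_at (bigD1 i) // rpredDr; last first.
    apply: rpred_sum => l li; apply: sub_mem; first exact: x'R.
    by eexists.
  have -> : x' i = v by rewrite /x' /= eqxx.
  have -> b : brk [eta x' with i |-> b] = brk [eta x with i |-> b].
    by apply: brk_eq => k; rewrite /x' /=; case: eqVneq.
  move=> viR; have := rpredB viR (sub_mod x i _ _ w0R).
  by rewrite subKr => /(rpredZ a0^-1); rewrite scalerA mulVf // scale1r.
move=> w k; rewrite brk_fundamental_at; apply: rpred_sum => l _.
by apply: sub_mem => //; eexists.
Qed.

(** * The multiplier *)

Section Presentation.
Variables (K : fieldType) (n d : nat) (H F : nLieType K n).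
Variables (R : nideal F) (p : {linear F -> H}).
Hypothesis n_gt0 : (0 < n)%N.
Hypothesis nd : (n < d)%N.
Hypothesis H_heisenberg : heisenberg H.
Hypothesis H_dim : has_dim H d.+1.
Hypothesis p_morphism : nlie_morphism p.
Hypothesis p_surjective : forall h : H, exists u : F, p u = h.
Hypothesis R_kernel : forall u : F, u \in R <-> p u = 0.
Let o : 'I_n := Ordinal n_gt0.
Let S := preim_ideal p_morphism (lcs H 2).

Let lcs2_brk (L : nLieType K n) (x : 'I_n -> L) : brk x \in lcs L 2.
Proof. exact: (lprod_mem (i := o)). Qed.

Let SE v : (v \in S) = (p v \in lcs H 2).
Proof. by []. Qed.

(** The element v of [brk_commutator_lprod] is a lift of the element provided by
    [heisenberg_isotropic]. *)
Lemma lprod_preim_derived : {subset lprod S <= lprod R}.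
Proof.
have pR u v : p u = p v -> u - v \in R.
  by move=> uv; apply/R_kernel; rewrite linearB uv /= subrr.
have /choice[q qK] := p_surjective.
have [xH z0 H2z] := heisenberg_derived_line n_gt0 H_heisenberg.
pose x : 'I_n -> F := q \o xH.
have px : p (brk x) = brk xH.
  by rewrite p_morphism; apply: brk_eq => i; rewrite /= qK.
have brkR (w : 'I_n -> F) : exists a, brk w - a *: brk x \in R.
  have [a wE] := H2z _ (lcs2_brk (p \o w)).
  by exists a; apply: pR; rewrite linearZ /= px p_morphism.
have uR (w : 'I_n -> F) k : brk [eta w with k |-> brk x] \in lprod R.
  have [h hZ h_perp] := heisenberg_isotropic n_gt0 H_heisenberg nd H_dim z0 H2z.
  apply: (@brk_commutator_lprod _ _ _ R x (q h)) => // [i|].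
    apply/R_kernel; rewrite p_morphism -(h_perp i); apply: brk_eq => j /=.
    by case: eqVneq; rewrite qK.
  move: hZ => /asboolPn/existsNP[y /eqP hy].
  have [a aE] := H2z _ (lcs2_brk (hcons h y)).
  exists (q \o y), o, a.
    by apply: contraNneq hy => a0; rewrite aE a0 scale0r.
  apply: pR; rewrite linearZ /= px -aE p_morphism; apply: brk_eq => j /=.
  by rewrite /hcons -[j == o]/(j == 0 :> nat); case: eqP; rewrite /= qK.
move=> v; apply: (lprod_ind (o := o) _ (nsubalg_submod (lprod R))) => // w.
rewrite SE => /H2z[a wE]; rewrite -(brk_eq (upd_id w o)).
rewrite -(subrK (a *: brk [eta w with o |-> brk x]) (brk _)).
apply: rpredD; last exact/rpredZ/uR.
rewrite -brk_updZ -brk_updB; apply: (lprod_mem (i := o)); rewrite /= ?eqxx.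
by apply: pR; rewrite linearZ /= px.
Qed.

Lemma gamma3_preim_derived : {subset gamma3 S <= gamma3 R}.
Proof. exact/lprodS/lprod_preim_derived. Qed.

Lemma lcs2_sub_preim v : v \in lcs F 2 -> v \in S.
Proof. by rewrite SE; exact: (morph_lcs (i := 2) n_gt0 p_morphism). Qed.

Lemma lcs3_sub_kernel v : v \in lcs F 3 -> v \in R.
Proof.
move=> /(morph_lcs n_gt0 p_morphism) /(heisenberg_lcs3 n_gt0 H_heisenberg).
by move/R_kernel.
Qed.

Lemma multiplier2_brk_eq0 (x : 'I_n -> multiplier2 R) : brk x = 0.
Proof.
apply: subquot_brk_eq0 => y yRF.
apply: gamma3_preim_derived; apply: (lprod_mem (i := o)).
by have /andP[_] := yRF o; apply: lprodS => v; exact: lcs2_sub_preim.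
Qed.

(** With S in place of R, the multiplier is F^3 / gamma_3(S), which only sees F
    modulo S. So a lift of a basis of H/H^2 and the coordinates in that basis
    induce mutually inverse maps, although neither is invertible on F. *)
Lemma multiplier2_free_layer (X : Type) (iota : X -> F) (G : nLieType K n)
    (g : 'I_d -> G) : is_free iota -> is_free g ->
  exists2 Psi : multiplier2 R -> subquot (lcs G 3) (lcs G 4),
    linear Psi & bijective Psi.
Proof.
move=> F_free G_free.
have /choice[q qK] := p_surjective.
have [xH z0 H2z] := heisenberg_derived_line n_gt0 H_heisenberg.
have [c [b [cz cb cE]]] := complement_line H_dim z0.
have [[phi phiM phiE] _] := G_free F (q \o b).
(* The linear coordinate map, not a morphism; psi is its multiplicative
   extension from the generators. *)
pose s : {linear F -> G} := lincomb g \o c \o p.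
have [[psi psiM psiE] _] := F_free G (s \o iota).
have s_brk w : s (brk w) = 0.
  rewrite /s /= p_morphism; have [a ->] := H2z _ (lcs2_brk (p \o w)).
  by rewrite linearZ /= cz scaler0 linear0.
(* psi and s agree on the generators, but s kills all brackets. *)
have psi_s : forall v, psi v - s v \in lcs G 2.
  apply: (free_morph_congr F_free) => [w|w|t].
  - by rewrite psiM lcs2_brk.
  - by rewrite s_brk rpred0.
  by rewrite psiE subrr rpred0.
have psi_R v : v \in R -> psi v \in lcs G 2.
  move=> /R_kernel pv; rewrite -(subrK (s v) (psi v)) rpredD //.
  have -> : s v = 0 by rewrite /s /= pv !linear0.
  exact: rpred0.
have phipsiM : nlie_morphism (phi \o psi : {linear F -> F}).
  by move=> w; rewrite /= psiM phiM.
have psiphiM : nlie_morphism (psi \o phi : {linear G -> G}).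
  by move=> w; rewrite /= phiM psiM.
have phipsi_S : forall v, (phi \o psi : {linear F -> F}) v - v \in S.
  apply: (free_morph_congr (g := idfun) F_free) => [w|w|t].
  - by rewrite SE phipsiM p_morphism lcs2_brk.
  - by rewrite SE p_morphism lcs2_brk.
  have [a aE] := cE (p (iota t)).
  have pE : p (phi (psi (iota t))) = \sum_j c (p (iota t)) 0 j *: b j.
    rewrite psiE /s /= !linear_sum; apply: eq_bigr => j _.
    by rewrite !linearZ /= phiE /= qK.
  (* The coordinates are only those modulo H^2. *)
  rewrite SE linearB -[p ((_ \o _) _)]/(p (phi (psi (iota t)))) pE {2}aE.
  by rewrite opprD addNKr -scaleNr rpredZ // lcs2_brk.
have psiphi_G2 : forall v, (psi \o phi : {linear G -> G}) v - v \in lcs G 2.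
  apply: (free_morph_congr (g := idfun) G_free) => [w|w|j].
  - by rewrite psiphiM lcs2_brk.
  - exact: lcs2_brk.
  have sg : s (phi (g j)) = g j by rewrite /s /= phiE /= qK cb lincomb_delta.
  by have := psi_s (phi (g j)); rewrite sg.
have psi_AB v : v \in meet_subalg R (lcs F 3) -> psi v \in lcs G 3.
  by move=> /andP[_]; exact: morph_lcs.
have psi_IJ v : v \in meet_subalg R (lcs F 3) -> v \in gamma3 R ->
    psi v \in lcs G 4.
  move=> _; apply: (morph_lprod n_gt0 psiM) => {}v.
  exact: (morph_lprod n_gt0 psiM).
have phi_BA v : v \in lcs G 3 -> phi v \in meet_subalg R (lcs F 3).
  move=> /(morph_lcs n_gt0 phiM) vF; apply/andP; split=> //.
  exact: lcs3_sub_kernel.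
have phi_JI v : v \in lcs G 3 -> v \in lcs G 4 -> phi v \in gamma3 R.
  move=> _ vG; apply: gamma3_preim_derived; move: v vG.
  do 2!apply: (morph_lprod n_gt0 phiM); move=> v.
  move=> vG; apply: lcs2_sub_preim.
  exact: (morph_lcs (i := 2) n_gt0 phiM).
pose Psi : multiplier2 R -> subquot (lcs G 3) (lcs G 4) :=
  subquot_map (lcs G 4) psi_AB.
have Psi_bij : bijective Psi.
  exists (subquot_map (gamma3 R) phi_BA).
    apply: subquot_mapK => // v /andP[_ vF]; apply: gamma3_preim_derived.
    exact: (morph_congr_lcs3 n_gt0 phipsiM phipsi_S).
  apply: subquot_mapK => // v vG.
  exact: (morph_congr_lcs3 n_gt0 psiphiM psiphi_G2).
by exists Psi => //; exact: (subquot_map_linear psi_AB psi_IJ).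
Qed.

End Presentation.

Theorem theorem2p5 (K : fieldType) (n m : nat)
    (n_ge2 : (2 <= n)%N) (m_ge2 : (2 <= m)%N)
    (H : nLieType K n) (H_heisenberg : heisenberg H)
    (H_dim : has_dim H (m * n + 1)%N)
    (X : Type) (F : nLieType K n) (iota : X -> F) (F_free : is_free iota)
    (R : nideal F) (p : {linear F -> H}) (p_morphism : nlie_morphism p)
    (p_surjective : forall h : H, exists u : F, p u = h)
    (R_kernel : forall u : F, u \in R <-> p u = 0) :
  nlie_isomorphic (multiplier2 R)
    (abelian_nlie K (basic_commutator_count K n (m * n) 3)).
Proof.
have n_gt0 : (0 < n)%N by exact: ltnW.
set d := (m * n)%N in H_dim *; rewrite addn1 in H_dim.
(* The codimension of the centre exceeds n because m > 1. *)
have nd : (n < d)%N by rewrite /d -{1}[n]mul1n ltn_pmul2r.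
have [G [g [G_free [[r r_lin r_bij]]]]] := free_lcs3_dim K n_gt0 d.
have [Psi Psi_lin Psi_bij] := multiplier2_free_layer n_gt0 nd H_heisenberg H_dim
  p_morphism p_surjective R_kernel F_free G_free.
pose T : multiplier2 R -> abelian_nlie K (basic_commutator_count K n d 3) :=
  r \o Psi.
have T_lin : linear T by move=> a u v; rewrite /T /= Psi_lin r_lin.
pose TM := GRing.isLinear.Build _ _ _ _ T T_lin.
pose TL : {linear multiplier2 R ->
    abelian_nlie K (basic_commutator_count K n d 3)} := HB.pack T TM.
exists TL; last exact: bij_comp.
move=> w.
rewrite (multiplier2_brk_eq0 n_gt0 nd H_heisenberg H_dim p_morphism) //.
exact: linear0.
Qed.
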